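(* Let $d\geqslant 1$ and let $Z=\{z_1,\ldots,z_m\}$ be a finite multiset of points of the unit sphere $\mathbb{S}^{d-1}$. Assume $Z$ is ample. Then the constellation complex $\operatorname{Stel}(Z)$ is homotopy equivalent to the sphere $S^{d-1}$.
   Context: $\mathbb{S}^{d-1}$ is the unit sphere centered at the origin in a Euclidean space $V\cong\mathbb{R}^d$. A spherical configuration is a finite multiset $Z=\{z_1,\ldots,z_m\}\subset\mathbb{S}^{d-1}$ (repetitions allowed). For $z\in\mathbb{S}^{d-1}$ the open hemisphere centered in $z$ is $D(z)=\{x\in\mathbb{S}^{d-1}\mid\langle x,z\rangle>0\}$. $Z$ is ample if every open hemisphere contains at least one point of $Z$ (equivalently, $\mathbb{S}^{d-1}=\bigcup_{i=1}^m D(z_i)$). The constellation complex is the abstract simplicial complex on the vertex set $[m]=\{1,\ldots,m\}$ given by $$\operatorname{Stel}(Z)=\{\{i_1,\ldots,i_k\}\subseteq[m]\mid z_{i_1},\ldots,z_{i_k}\text{ lie in a single open hemisphere}\}.$$ Statements about the homotopy type of a simplicial complex refer to its geometric realization. *)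

(* Defs.v *)
From HB Require Import structures.
From mathcomp Require Import all_boot all_order all_algebra.
From mathcomp Require Import all_classical all_reals all_analysis.

Set Implicit Arguments.
Unset Strict Implicit.
Unset Printing Implicit Defensive.

Import Order.TTheory GRing.Theory Num.Theory.
Import numFieldNormedType.Exports.

Local Open Scope classical_set_scope.
Local Open Scope ring_scope.

(* A homotopy is a map on X * [0, 1]; it is represented by a map on X * R that
   is continuous on X * [0, 1], its values elsewhere being irrelevant. *)
Definition homotopic (R : realType) (X Y : topologicalType) (f g : X -> Y) :=
  exists H : X * R -> Y,
    [/\ {within [set: X] `*` `[0, 1], continuous H},
        (forall x, H (x, 0) = f x) & (forall x, H (x, 1) = g x)].

Definition homotopy_equivalent (R : realType) (X Y : topologicalType) :=
  exists (f : X -> Y) (g : Y -> X),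
    [/\ continuous f, continuous g,
        homotopic R (g \o f) idfun & homotopic R (f \o g) idfun].

Record simplicial_complex (m : nat) := SimplicialComplex {
  faces :> set {set 'I_m};
  faces_set1 : forall i, faces [set i]%SET;
  faces_subset : forall A B : {set 'I_m}, A \subset B -> faces B -> faces A }.

(* Barycentric coordinates. As the vertex set is finite, the topology induced
   by R^m is the weak (simplex-wise) topology. *)
Definition geometric_realization (R : realType) (m : nat)
    (K : simplicial_complex m) : set 'rV[R]_m :=
  [set t : 'rV[R]_m |
     [/\ forall i, 0 <= t 0 i,
         \sum_i t 0 i = 1 &
         faces K [set i | t 0 i != 0]%SET]].
Arguments geometric_realization R {m} K.

Definition inner (R : realType) (d : nat) (x y : 'rV[R]_d) : R :=
  \sum_i x 0 i * y 0 i.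

(* The library norm on 'rV[R]_d is the sup norm, hence the use of inner. *)
Definition unit_sphere (R : realType) (d : nat) : set 'rV[R]_d :=
  [set x : 'rV[R]_d | inner x x = 1].
Arguments unit_sphere : clear implicits.

Definition open_hemisphere (R : realType) (d : nat) (z : unit_sphere R d) :
    set (unit_sphere R d) :=
  [set x : unit_sphere R d | 0 < inner (\val x) (\val z)].

(* A finite multiset of m points is given by an indexing Z by 'I_m. *)
Definition ample (R : realType) (d m : nat) (Z : 'I_m -> unit_sphere R d) :=
  forall z : unit_sphere R d, exists i, open_hemisphere z (Z i).

Section constellation_complex.
Context (R : realType) (d m : nat) (Z : 'I_m -> unit_sphere R d).

Definition Stel_faces : set {set 'I_m} :=
  [set A : {set 'I_m} | exists z : unit_sphere R d,
     forall i, i \in A -> open_hemisphere z (Z i)].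

Lemma Stel_faces_set1 i : Stel_faces [set i]%SET.
Proof.
exists (Z i) => j /set1P ->; rewrite /open_hemisphere /=.
by have /set_mem /= -> := valP (Z i); exact: ltr01.
Qed.

Lemma Stel_faces_subset (A B : {set 'I_m}) :
  A \subset B -> Stel_faces B -> Stel_faces A.
Proof. by move=> /fintype.subsetP AB [z Bz]; exists z => i /AB /Bz. Qed.

Definition Stel := SimplicialComplex Stel_faces_set1 Stel_faces_subset.

End constellation_complex.

(* Main.v *)
Require Import Defs.
From mathcomp Require Import all_boot all_order all_algebra.
From mathcomp Require Import all_classical all_reals all_analysis.
From mathcomp Require Import lra.
Import numFieldNormedType.Exports.

(** The maps [t |-> sum_i t_i z_i] and [x |-> (max 0 <x, z_i>)_i], suitably
    normalized, are homotopy inverse to each other. On the sphere, [x] has a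
    positive inner product with the image [u] of [x] under the composite, so the
    segment from [u] to [x] avoids the origin. On the complex, let
    [y = sum_i t_i z_i] and [p_i = max 0 <y, z_i>]. The supports of [t] and [p]
    need not lie in a common face, but [<y, y> = sum_i t_i <y, z_i>] is positive,
    so [(t_i p_i)_i] is nonzero; its support lies in both the support of [p] and
    that of [t], and [p] is joined to [t] by two segments through it. *)

Set Implicit Arguments.
Unset Strict Implicit.
Unset Printing Implicit Defensive.

Import Order.TTheory GRing.Theory Num.Theory.
Local Open Scope classical_set_scope.
Local Open Scope ring_scope.

(** * Continuity of real-valued and row-valued maps *)

Lemma continuous_compose (X Y T : topologicalType) (f : X -> Y) (g : Y -> T) :
  continuous f -> continuous g -> continuous (fun x => g (f x)).
Proof. by move=> fc gc x; apply: (continuous_comp (fc x)); exact: gc. Qed.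

Section continuity.
Context {R : realType} {X : topologicalType}.
Implicit Types f g : X -> R.

Lemma continuous_set_type (T : topologicalType) (A : set T) (f : X -> A) :
  continuous (fun x => \val (f x)) -> continuous f.
Proof. exact: (@continuous_comp_initial A X T set_val f). Qed.

Lemma continuous_val (T : topologicalType) (A : set T) :
  continuous (\val : A -> T).
Proof. exact: initial_continuous. Qed.

(** A neighbourhood of a row contains a product of neighbourhoods of its finitely many entries. *)
Lemma continuous_row n (v : X -> 'rV[R]_n) :
  (forall j, continuous (fun x => v x 0 j)) -> continuous v.
Proof.
move=> vc x A [P xP PA].
have : \forall y \near x, forall j, P 0 j (v y 0 j).
  apply: (@filter_forall _ _ (fun j y => P 0 j (v y 0 j))) => j.
  by apply: (vc j); exact: xP.
by apply: filterS => y Py; apply: PA => i j; rewrite ord1.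
Qed.

Lemma continuous_entry n (v : X -> 'rV[R]_n) j :
  continuous v -> continuous (fun x => v x 0 j).
Proof.
by move=> vc; apply: (@continuous_compose _ _ _ v (fun w => w 0 j)) => // w;
  exact: coord_continuous.
Qed.

Lemma continuous_mulr f g :
  continuous f -> continuous g -> continuous (fun x => f x * g x).
Proof. by move=> fc gc x; apply: continuousM; [exact: fc|exact: gc]. Qed.

Lemma continuous_addr f g :
  continuous f -> continuous g -> continuous (fun x => f x + g x).
Proof. by move=> fc gc x; apply: continuousD; [exact: fc|exact: gc]. Qed.

Lemma continuous_subr f g :
  continuous f -> continuous g -> continuous (fun x => f x - g x).
Proof. by move=> fc gc x; apply: continuousB; [exact: fc|exact: gc]. Qed.

Lemma continuous_invr f :
  (forall x, f x != 0) -> continuous f -> continuous (fun x => (f x)^-1).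
Proof. by move=> f0 fc x; apply: continuousV; [exact: f0|exact: fc]. Qed.

Lemma continuous_max0 f :
  continuous f -> continuous (fun x => Num.max 0 (f x)).
Proof.
by move=> fc x; apply: continuous_max; [exact: cvg_cst|exact: fc].
Qed.

Lemma continuous_sumr n (F : 'I_n -> X -> R) :
  (forall i, continuous (F i)) -> continuous (fun x => \sum_i F i x).
Proof.
by move=> Fc x; apply: cvg_big => [|i _]; [exact: add_continuous|exact: Fc].
Qed.

Lemma continuous_inner n (u v : X -> 'rV[R]_n) :
  continuous u -> continuous v -> continuous (fun x => inner (u x) (v x)).
Proof.
move=> uc vc; apply: continuous_sumr => i.
by apply: continuous_mulr; exact: continuous_entry.
Qed.

Lemma continuous_scaler n f (v : X -> 'rV[R]_n) :
  continuous f -> continuous v -> continuous (fun x => f x *: v x).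
Proof.
move=> fc vc; apply: continuous_row => j.
under eq_fun do rewrite mxE.
by apply: continuous_mulr => //; exact: continuous_entry.
Qed.

Lemma continuous_addrow n (u v : X -> 'rV[R]_n) :
  continuous u -> continuous v -> continuous (fun x => u x + v x).
Proof.
move=> uc vc; apply: continuous_row => j.
under eq_fun do rewrite mxE.
by apply: continuous_addr; exact: continuous_entry.
Qed.

End continuity.

(** * The Euclidean inner product *)

Section inner.
Context {R : realType} {d : nat}.
Implicit Types (a : R) (u v w : 'rV[R]_d).

Lemma innerC u v : inner u v = inner v u.
Proof. by apply: eq_bigr => i _; rewrite mulrC. Qed.

Lemma innerDl u v w : inner (u + v) w = inner u w + inner v w.
Proof. by rewrite -big_split; apply: eq_bigr => i _; rewrite mxE mulrDl. Qed.

Lemma innerZl a u v : inner (a *: u) v = a * inner u v.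
Proof. by rewrite /inner mulr_sumr; apply: eq_bigr => i _; rewrite mxE mulrA. Qed.

Lemma inner_suml n (F : 'I_n -> 'rV[R]_d) v :
  inner (\sum_i F i) v = \sum_i inner (F i) v.
Proof.
rewrite /inner exchange_big; apply: eq_bigr => j _.
by rewrite summxE mulr_suml.
Qed.

(** If [inner u u] vanishes, so does every entry of [u], and [u] pairs to zero with every [v]. A
    single positive pairing thus allows [u] to be normalized. *)
Lemma inner_gt0 u v : 0 < inner u v -> 0 < inner u u.
Proof.
move=> uv; rewrite lt0r sumr_ge0 ?andbT; last by move=> i _; rewrite -expr2 sqr_ge0.
apply: contraTneq uv => /eqP.
rewrite psumr_eq0 => [/allP u0|i _]; last by rewrite -expr2 sqr_ge0.
rewrite /inner big1 ?ltxx // => i _.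
by have := u0 i (mem_index_enum _); rewrite /= mulf_eq0 orbb => /eqP ->; rewrite mul0r.
Qed.

End inner.

(** * Normalization onto the sphere and onto the realization *)

Section normalization.
Context {R : realType} {X : topologicalType}.

Lemma normalize_sphere d (v : X -> 'rV[R]_d) :
    continuous v -> (forall x, 0 < inner (v x) (v x)) ->
  exists2 f : X -> unit_sphere R d, continuous f &
    forall x, \val (f x) = (Num.sqrt (inner (v x) (v x)))^-1 *: v x.
Proof.
move=> vc v0.
have fS x : unit_sphere R d ((Num.sqrt (inner (v x) (v x)))^-1 *: v x).
  rewrite /unit_sphere /= innerZl innerC innerZl mulrA -expr2 exprVn.
  by rewrite sqr_sqrtr ?ltW// mulVf// gt_eqF.
exists (fun x => SigSub (mem_set (fS x))) => //.
apply: continuous_set_type; apply: continuous_scaler => //.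
apply: continuous_invr => x; first by rewrite gt_eqF ?sqrtr_gt0.
apply: (@continuous_compose _ _ _ (fun x => inner (v x) (v x)) Num.sqrt).
  exact: continuous_inner.
exact: sqrt_continuous.
Qed.

(** Dividing by the positive coordinate sum does not enlarge the support, so the image stays in the
    face given for [p x]. *)
Lemma normalize_realization m (K : simplicial_complex m) (p : X -> 'rV[R]_m) :
    continuous p -> (forall x i, 0 <= p x 0 i) ->
    (forall x, 0 < \sum_i p x 0 i) ->
    (forall x, faces K [set i | p x 0 i != 0]%SET) ->
  exists2 f : X -> geometric_realization R K, continuous f &
    forall x, \val (f x) = (\sum_i p x 0 i)^-1 *: p x.
Proof.
move=> pc p0 sp pK.
have fK x : geometric_realization R K ((\sum_i p x 0 i)^-1 *: p x).
  split=> [i||].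
  - by rewrite mxE mulr_ge0 // invr_ge0 ltW.
  - under eq_bigr do rewrite mxE.
    by rewrite -mulr_sumr mulVf// gt_eqF.
  - apply: faces_subset (pK x); apply/fintype.subsetP => i.
    by rewrite !inE mxE mulf_eq0 negb_or => /andP[].
exists (fun x => SigSub (mem_set (fK x))) => //.
apply: continuous_set_type; apply: continuous_scaler => //.
apply: continuous_invr => [x|]; first by rewrite gt_eqF.
by apply: continuous_sumr => i; exact: continuous_entry.
Qed.

End normalization.

(** * The two maps between the complex and the sphere, before normalization *)

Section constellation.
Context {R : realType} {d m : nat} (Z : 'I_m -> unit_sphere R d).

Let z i : 'rV[R]_d := \val (Z i).

Definition weighted_sum (t : 'rV[R]_m) : 'rV[R]_d := \sum_i t 0 i *: z i.

(** On the sphere, the entry [i] is nonzero exactly on the open hemisphere centred at [z i]; for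
    ample [Z], normalizing gives a partition of unity for this cover. *)
Definition hemisphere_weights (x : 'rV[R]_d) : 'rV[R]_m :=
  \row_i Num.max 0 (inner x (z i)).

Lemma inner_weighted_sum t x :
  inner (weighted_sum t) x = \sum_i t 0 i * inner x (z i).
Proof.
by rewrite inner_suml; apply: eq_bigr => i _; rewrite innerZl innerC.
Qed.

Lemma hemisphere_weights_ge0 x i : 0 <= hemisphere_weights x 0 i.
Proof. by rewrite mxE le_max lexx. Qed.

Lemma hemisphere_weights_neq0 x i :
  (hemisphere_weights x 0 i != 0) = (0 < inner x (z i)).
Proof. by rewrite mxE; case: ltP => [/gt_eqF ->//|]; rewrite eqxx. Qed.

(** The support of [t] lies in the hemisphere of some [w], so the pairing with [w] is a sum of
    nonnegative terms. They cannot all vanish, since the coordinates of [t] sum to 1. *)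
Lemma weighted_sum_gt0 t : geometric_realization R (Stel Z) t ->
  0 < inner (weighted_sum t) (weighted_sum t).
Proof.
case=> t0 t1 [w wt]; apply: (@inner_gt0 _ _ _ (\val w)).
have zw i : t 0 i != 0 -> 0 < inner (\val w) (z i).
  by move=> ti; rewrite innerC wt // inE.
have ge0 i : 0 <= t 0 i * inner (\val w) (z i).
  have [->|/zw/ltW wi] := eqVneq (t 0 i) 0; first by rewrite mul0r.
  exact: mulr_ge0.
rewrite inner_weighted_sum lt0r sumr_ge0 // andbT.
apply: contra_eq_neq t1 => /eqP; rewrite psumr_eq0 // => /allP s0.
rewrite big1 1?eq_sym ?oner_eq0 // => i _; apply/eqP; apply: contraT => ti.
have := s0 i (mem_index_enum _).
by rewrite mulf_eq0 (negPf ti) gt_eqF // zw.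
Qed.

(** The hemisphere centred at [x] itself witnesses the face. *)
Lemma Stel_hemisphere_weights (x : unit_sphere R d) :
  faces (Stel Z) [set i | hemisphere_weights (\val x) 0 i != 0]%SET.
Proof.
by exists x => i; rewrite inE hemisphere_weights_neq0 /open_hemisphere /= innerC.
Qed.

Lemma sum_hemisphere_weights_gt0 (x : unit_sphere R d) : ample Z ->
  0 < \sum_i hemisphere_weights (\val x) 0 i.
Proof.
move=> /(_ x)[i xi]; rewrite (bigD1 i) //= ltr_pwDl //.
  by rewrite lt0r hemisphere_weights_neq0 innerC xi hemisphere_weights_ge0.
by apply: sumr_ge0 => j _; exact: hemisphere_weights_ge0.
Qed.

(** The pairing is the sum of the squared weights, one of which is positive by ampleness. *)
Lemma inner_weighted_sum_hemisphere_weights (x : unit_sphere R d) : ample Z ->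
  0 < inner (weighted_sum (hemisphere_weights (\val x))) (\val x).
Proof.
move=> /(_ x)[i xi]; rewrite inner_weighted_sum.
have ge0 j : 0 <= hemisphere_weights (\val x) 0 j * inner (\val x) (z j).
  rewrite mxE; case: (ltP 0 (inner _ _)) => [/ltW xj|_]; [exact: mulr_ge0|by rewrite mul0r].
rewrite (bigD1 i) //= ltr_pwDl ?sumr_ge0 // mulr_gt0 // 1?innerC //.
by rewrite lt0r hemisphere_weights_neq0 innerC xi hemisphere_weights_ge0.
Qed.

Lemma continuous_weighted_sum (X : topologicalType) (t : X -> 'rV[R]_m) :
  continuous t -> continuous (fun x => weighted_sum (t x)).
Proof.
move=> tc; apply: continuous_row => j.
under eq_fun do rewrite summxE.
apply: continuous_sumr => i.
under eq_fun do rewrite mxE.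
apply: continuous_mulr; first exact: continuous_entry.
by move=> ?; exact: cvg_cst.
Qed.

Lemma continuous_hemisphere_weights (X : topologicalType) (v : X -> 'rV[R]_d) :
  continuous v -> continuous (fun x => hemisphere_weights (v x)).
Proof.
move=> vc; apply: continuous_row => j.
under eq_fun do rewrite mxE.
apply: continuous_max0; apply: continuous_inner => // ?; exact: cvg_cst.
Qed.

End constellation.

(** * The normalized maps and the two homotopies *)

Theorem theorem1 (R : realType) (d m : nat) (Z : 'I_m -> unit_sphere R d)
    (d_ge1 : (1 <= d)%N) (Z_ample : ample Z) :
  homotopy_equivalent R
    (set_type (geometric_realization R (Stel Z))) (set_type (unit_sphere R d)).
Proof.
set K := geometric_realization R (Stel Z); set S := unit_sphere R d.
have KP (t : K) : K (\val t) by exact: set_mem (valP t).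
have SP (x : S) : inner (\val x) (\val x) = 1 by exact: set_mem (valP x).
have [f fc fE] := @normalize_sphere R K d (fun t => weighted_sum Z (\val t))
  (continuous_weighted_sum (@continuous_val _ _))
  (fun t => weighted_sum_gt0 (KP t)).
have [g gc gE] := @normalize_realization R S m (Stel Z)
  (fun x => hemisphere_weights Z (\val x))
  (continuous_hemisphere_weights (@continuous_val _ _))
  (fun x => hemisphere_weights_ge0 Z _)
  (fun x => sum_hemisphere_weights_gt0 x Z_ample)
  (Stel_hemisphere_weights Z).
exists f, g; split => //.
(* Homotopy on the complex. The weights [p] are taken at the unit vector [f t], a positive multiple
   of the weighted sum, which does not affect their support. *)
- have p_gt0 (t : K) : 0 < \sum_i hemisphere_weights Z (\val (f t)) 0 i.
    exact: sum_hemisphere_weights_gt0.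
  have tp_gt0 (t : K) :
      0 < \sum_i \val t 0 i * hemisphere_weights Z (\val (f t)) 0 i.
    have [t0 _ _] := KP t.
    (* Each weight bounds the inner product of [f t] with the corresponding point from above, so the
       sum dominates the pairing of the weighted sum with its own normalization. *)
    apply: (@lt_le_trans _ _ (inner (weighted_sum Z (\val t)) (\val (f t)))).
      rewrite fE innerC innerZl mulr_gt0 // ?invr_gt0 ?sqrtr_gt0;
        exact: (weighted_sum_gt0 (KP t)).
    rewrite inner_weighted_sum; apply: ler_sum => i _.
    by rewrite ler_wpM2l // mxE le_max lexx orbT.
  (* The path [a p + b t p + c t], before normalization. *)
  pose a (s : R) := Num.max 0 (1 - 2 * s).
  pose b (s : R) := Num.max 0 (s * (1 - s)).
  pose c (s : R) := Num.max 0 (2 * s - 1).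
  (* Truncation at 0 keeps the coefficients nonnegative for every real [s], as the homotopy must
     take values in the complex on all of [K * R]. *)
  have a_ge0 s : 0 <= a s by rewrite le_max lexx.
  have b_ge0 s : 0 <= b s by rewrite le_max lexx.
  have c_ge0 s : 0 <= c s by rewrite le_max lexx.
  have a_gt0 s : s < 2^-1 -> 0 < a s.
    by move=> s2; rewrite lt_max; apply/orP; right; lra.
  have b_gt0 : 0 < b 2^-1 by rewrite lt_max; apply/orP; right; lra.
  have c_gt0 s : 2^-1 < s -> 0 < c s.
    by move=> s2; rewrite lt_max; apply/orP; right; lra.
  have a_eq0 s : 2^-1 <= s -> a s = 0 by move=> s2; apply: max_l; lra.
  have c_eq0 s : s <= 2^-1 -> c s = 0 by move=> s2; apply: max_l; lra.
  have a0 : a 0 = 1 by rewrite /a mulr0 subr0 max_r.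
  have b0 : b 0 = 0 by rewrite /b mul0r maxxx.
  have b1 : b 1 = 0 by rewrite /b subrr mulr0 maxxx.
  have c1 : c 1 = 1 by rewrite /c max_r; lra.
  pose q (x : K * R) : 'rV[R]_m := \row_i
    (a x.2 * hemisphere_weights Z (\val (f x.1)) 0 i +
     b x.2 * (\val x.1 0 i * hemisphere_weights Z (\val (f x.1)) 0 i) +
     c x.2 * \val x.1 0 i).
  have sc : continuous (fun x : K * R => x.2) by move=> x; exact: cvg_snd.
  have cc (r : R) : continuous (fun _ : K * R => r) by move=> x; exact: cvg_cst.
  have tc : continuous (fun x : K * R => \val x.1).
    by apply: (continuous_compose _ (@continuous_val _ _)) => x; exact: cvg_fst.
  have pc : continuous (fun x : K * R => hemisphere_weights Z (\val (f x.1))).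
    apply: continuous_hemisphere_weights.
    apply: (continuous_compose _ (@continuous_val _ _)).
    by apply: (continuous_compose _ fc) => x; exact: cvg_fst.
  have ac : continuous (fun x : K * R => a x.2).
    apply: continuous_max0; apply: (continuous_subr (cc _)).
    exact: (continuous_mulr (cc _) sc).
  have bc : continuous (fun x : K * R => b x.2).
    apply: continuous_max0; apply: (continuous_mulr sc).
    exact: (continuous_subr (cc _) sc).
  have cC : continuous (fun x : K * R => c x.2).
    apply: continuous_max0; apply: (continuous_subr _ (cc _)).
    exact: (continuous_mulr (cc _) sc).
  have [||||H Hc HE] := @normalize_realization R (K * R)%type m (Stel Z) q.
  + apply: continuous_row => j.
    under eq_fun do rewrite mxE.
    have pjc := continuous_entry (j := j) pc.
    have tjc := continuous_entry (j := j) tc.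
    apply: continuous_addr; last exact: continuous_mulr.
    apply: continuous_addr; first exact: continuous_mulr.
    by apply: (continuous_mulr bc); exact: continuous_mulr.
  + move=> x i; have [t0 _ _] := KP x.1.
    by rewrite mxE !addr_ge0 ?mulr_ge0 ?hemisphere_weights_ge0.
  + move=> [t s] /=; have [_ t1 _] := KP t.
    under eq_bigr do rewrite mxE.
    rewrite !big_split -!mulr_sumr /= t1 mulr1.
    have pa_ge0 := mulr_ge0 (a_ge0 s) (ltW (p_gt0 t)).
    have tpb_ge0 := mulr_ge0 (b_ge0 s) (ltW (tp_gt0 t)).
    (* The positive term is the one in [a] before 1/2, the one in [c] after 1/2, and the one in [b]
       at 1/2, where [a] and [c] both vanish. *)
    have [s0|s0] := ltP s 2^-1; last have [s1|s1] := ltP 2^-1 s.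
    * have pa_gt0 := mulr_gt0 (a_gt0 s s0) (p_gt0 t).
      exact: ltr_pwDl (ltr_pwDl pa_gt0 tpb_ge0) (c_ge0 s).
    * by rewrite ltr_wpDl ?addr_ge0 // c_gt0.
    * have b_s : 0 < b s by rewrite (@le_anti _ _ s 2^-1) // s0 s1.
      have tpb_gt0 := mulr_gt0 b_s (tp_gt0 t).
      exact: ltr_pwDl (ltr_wpDl pa_ge0 tpb_gt0) (c_ge0 s).
  + move=> [t s]; have [_ _ tF] := KP t.
    (* Up to 1/2 the term in [c] vanishes and the others carry a factor [p_i]; after 1/2 the term in
       [a] vanishes and the others carry a factor [t_i]. *)
    have [s0|s0] := leP s 2^-1.
    * apply: faces_subset (Stel_hemisphere_weights Z (f t)).
      apply/fintype.subsetP => i; rewrite !inE; apply: contraNneq => p0.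
      by rewrite mxE /= p0 !mulr0 !add0r c_eq0 ?mul0r.
    * apply: faces_subset tF.
      apply/fintype.subsetP => i; rewrite !inE; apply: contraNneq => t0.
      by rewrite mxE /= t0 mul0r !mulr0 !addr0 a_eq0 ?mul0r // ltW.
  exists H; split.
  + exact: continuous_subspaceT.
  + move=> t; apply: val_inj; rewrite HE /= gE.
    suff -> : q (t, 0) = hemisphere_weights Z (\val (f t)) by [].
    apply/rowP => i; rewrite mxE /= a0 b0 c_eq0 ?invr_ge0 //.
    by rewrite !mul0r !addr0 mul1r.
  + move=> t; apply: val_inj; rewrite HE /=.
    have -> : q (t, 1) = \val t.
      apply/rowP => i; rewrite mxE /= b1 c1 a_eq0 ?invf_le1 ?ler1n //.
      by rewrite !mul0r !add0r mul1r.
    by have [_ -> _] := KP t; rewrite invr1 scale1r.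
(* Homotopy on the sphere: the segment from [f (g x)] to [x], with coefficients truncated so that
   [v] avoids the origin at every real time. *)
- pose v (x : S * R) : 'rV[R]_d :=
    Num.max 0 (1 - x.2) *: \val (f (g x.1)) + Num.max 0 x.2 *: \val x.1.
  have fg_gt0 (x : S) : 0 < inner (\val (f (g x))) (\val x).
    rewrite fE innerZl mulr_gt0 //.
      rewrite invr_gt0 sqrtr_gt0; exact: (weighted_sum_gt0 (KP _)).
    (* The normalization in [g] is a positive scalar that comes out of the linear map
       [weighted_sum]. *)
    have -> : weighted_sum Z (\val (g x)) =
        (\sum_i hemisphere_weights Z (\val x) 0 i)^-1 *:
        weighted_sum Z (hemisphere_weights Z (\val x)).
      by rewrite gE scaler_sumr; apply: eq_bigr => i _; rewrite mxE scalerA.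
    rewrite innerZl mulr_gt0 ?invr_gt0 //; first exact: sum_hemisphere_weights_gt0.
    exact: inner_weighted_sum_hemisphere_weights.
  have sc : continuous (fun x : S * R => x.2) by move=> x; exact: cvg_snd.
  have xc : continuous (fun x : S * R => \val x.1).
    by apply: (continuous_compose _ (@continuous_val _ _)) => x; exact: cvg_fst.
  have fgc : continuous (fun x : S * R => \val (f (g x.1))).
    apply: (continuous_compose _ (@continuous_val _ _)).
    apply: (continuous_compose _ fc); apply: (continuous_compose _ gc) => x.
    exact: cvg_fst.
  have [||H Hc HE] := @normalize_sphere R (S * R)%type d v.
  + apply: continuous_addrow; apply: continuous_scaler => //; apply: continuous_max0 => //.
    by apply: continuous_subr => // x; exact: cvg_cst.
  + move=> x; apply: (@inner_gt0 _ _ _ (\val x.1)).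
    rewrite innerDl !innerZl SP mulr1.
    (* Before time 1 the coefficient of [f (g x)] is positive; from time 1 on that of [x] is. *)
    have [s0|s0] := ltP x.2 1.
    * rewrite ltr_pwDl // ?le_max ?lexx // mulr_gt0 // lt_max; apply/orP; right; lra.
    * rewrite ltr_wpDl // ?lt_max ?mulr_ge0 ?le_max ?lexx ?(ltW (fg_gt0 _)) //.
      apply/orP; right; lra.
  exists H; split.
  + exact: continuous_subspaceT.
  + move=> x; apply: val_inj; rewrite HE /=.
    have -> : v (x, 0) = \val (f (g x)).
      by rewrite /v /= subr0 max_r ?ler01 // maxxx scale0r addr0 scale1r.
    by rewrite SP sqrtr1 invr1 scale1r.
  + move=> x; apply: val_inj; rewrite HE /=.
    have -> : v (x, 1) = \val x.
      by rewrite /v /= subrr maxxx max_r // scale0r add0r scale1r.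
    by rewrite SP sqrtr1 invr1 scale1r.
Qed.
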